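(* Let $X$ be an irreducible Markov chain with transition matrix $P$ and stationary distribution $\mu$ on the finite connected graph $G=(V,E)$, and consider its associated electric network. Let $A,B\subset V$ be disjoint and non-empty, and start the chain from $\mu$ conditioned on being in $A$. Then the escape probability, i.e. the probability that the chain reaches $B$ before its first return to $A$, is $$\mathbf P\{\tau_B<\tau_A\}:=\sum_{x\in A}\frac{\mu_x}{\mu(A)}\mathbf P_x\{\tau_B<\tau_A\}=\frac{C^{\text{eff}}_{AB}}{\sum_{z\in A}\sum_{y\sim z}C_{zy}}.$$
   Context: Graphs are finite, connected and undirected, and loops are allowed; $x\sim y$ means that $x$ and $y$ are joined by an edge, with $x\sim x$ exactly when $x$ has a loop. A Markov chain on $G=(V,E)$ has $P_{xy}>0$ if and only if $x\sim y$; it need not be reversible. $\mathbf P_x$ is the law of the chain started from $x$, $\mu(A)=\sum_{x\in A}\mu_x$, and $\tau_A=\inf\{t>0:X(t)\in A\}$, similarly $\tau_B$. An electric network on $G$ consists of resistances $R_{xy}=R_{yx}>0$ and amplifier parameters $\lambda_{xy}>0$ with $\lambda_{yx}=1/\lambda_{xy}$ for $x\sim y$, with $\lambda_{xx}=1$ on loops. Put $C_{xy}=1/R_{xy}$, $\gamma_{xy}=\sqrt{\lambda_{xy}}=1/\gamma_{yx}$, $D_{xy}=\frac{2\gamma_{xy}}{1+\lambda_{xy}}C_{xy}=D_{yx}$. The network associated with the chain is the one with $D_{xy}=\sqrt{\mu_xP_{xy}\mu_yP_{yx}}$ and $\gamma_{xy}=\sqrt{\mu_xP_{xy}/(\mu_yP_{yx})}$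 (so $\lambda_{xy}=\gamma_{xy}^2$ and $C_{xy}=D_{xy}(1+\lambda_{xy})/(2\gamma_{xy})$). Potentials $(u_x)_{x\in V}$ and currents are related by $i_{xy}=D_{xy}(\gamma_{yx}u_x-\gamma_{xy}u_y)$. The incoming current to vertex $x$ is $i_x=\sum_{y\sim x}i_{xy}$; $x$ is free if $i_x=0$. For potentials prescribed on a nonempty set of vertices, with all others free, there is a unique solution $(u,i)$. For disjoint non-empty $A,B$, hold $A$ at constant potential $U_A$, $B$ at constant potential $U_B$, with all other vertices free, and put $i_A=\sum_{x\in A}i_x$. In the network associated with a chain there is a constant $R^{\text{eff}}_{AB}>0$, the effective resistance, with $U_A-U_B=R^{\text{eff}}_{AB}\, i_A$ for all $U_A,U_B\in\mathbb R$; the effective conductance is $C^{\text{eff}}_{AB}=1/R^{\text{eff}}_{AB}$. *)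

(* Defs.v *)
From HB Require Import structures.
From mathcomp Require Import all_boot all_order all_algebra.
From mathcomp Require Import ring.
From mathcomp Require Import all_classical all_reals all_analysis.

Set Implicit Arguments.
Unset Strict Implicit.
Unset Printing Implicit Defensive.

Import Order.TTheory GRing.Theory Num.Theory.
Import numFieldNormedType.Exports.

Local Open Scope classical_set_scope.
Local Open Scope ring_scope.

(* A finite undirected graph, possibly with loops, is a symmetric relation on a
   finite type. *)
Definition connected_graph (V : finType) (e : rel V) : Prop :=
  symmetric e /\ forall x y : V, connect e x y.

Section Chain.
Variables (R : realType) (V : finType).
Implicit Types (e : rel V) (P : V -> V -> R) (mu : V -> R).

Definition transition_matrix P : Prop :=
  (forall x y, 0 <= P x y) /\ (forall x, \sum_y P x y = 1).

Definition chain_on e P : Prop := forall x y, (0 < P x y) = e x y.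

Fixpoint nstep P (n : nat) (x y : V) : R :=
  if n is n'.+1 then \sum_z P x z * nstep P n' z y else (x == y)%:R.

Definition irreducible_chain P : Prop :=
  forall x y, exists n, 0 < nstep P n x y.

Definition stationary P mu : Prop :=
  [/\ forall x, 0 <= mu x, \sum_x mu x = 1
    & forall y, \sum_x mu x * P x y = mu y].

(* Under the law Q the process X is a Markov chain started at x with transition
   matrix P.  The Markov property is given in multiplied form, so that paths of
   probability zero need no special treatment. *)
Definition markov_from (d : measure_display) (Omega : measurableType d) P
    (X : nat -> Omega -> V) (Q : probability Omega R) (x : V) : Prop :=
  [/\ forall n y, measurable [set w | X n w = y],
      Q [set w | X 0%N w = x] = 1%E
    & forall n (s : nat -> V),
        Q [set w | forall k, (k <= n.+1)%N -> X k w = s k] =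
        (Q [set w | forall k, (k <= n)%N -> X k w = s k] *
         (P (s n) (s n.+1))%:E)%E].

(* The infimum is over strictly positive times and is +oo when the set is never
   visited. *)
Definition hitting_time (Omega : Type) (X : nat -> Omega -> V) (A : {set V})
    (w : Omega) : \bar R :=
  ereal_inf ((fun t : nat => (t%:R)%:E) @` [set t | (0 < t)%N && (X t w \in A)]).

End Chain.

(* Resistances and amplifier parameters; only the values on pairs joined by an
   edge are meaningful. *)
Record network (R : realType) (V : finType) := Network {
  res : V -> V -> R;
  amp : V -> V -> R
}.

Section Network.
Variables (R : realType) (V : finType) (e : rel V).
Implicit Types (N : network R V) (u : V -> R) (A B : {set V}).

Definition electric_network N : Prop :=
  [/\ forall x y, e x y -> 0 < res N x y /\ res N x y = res N y x,
      forall x y, e x y -> 0 < amp N x y /\ amp N y x = (amp N x y)^-1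
    & forall x, e x x -> amp N x x = 1].

Definition cond N x y : R := (res N x y)^-1.
Definition gam N x y : R := Num.sqrt (amp N x y).
Definition dcond N x y : R := 2 * gam N x y / (1 + amp N x y) * cond N x y.

Definition current N u x y : R :=
  dcond N x y * (gam N y x * u x - gam N x y * u y).

Definition vertex_current N u x : R := \sum_(y | e x y) current N u x y.

Definition set_current N u A : R := \sum_(x in A) vertex_current N u x.

Definition held_potential N A B (UA UB : R) u : Prop :=
  [/\ forall x, x \in A -> u x = UA, forall x, x \in B -> u x = UB
    & forall x, x \notin A :|: B -> vertex_current N u x = 0].

Definition is_eff_resistance N A B (r : R) : Prop :=
  0 < r /\
  forall UA UB u, held_potential N A B UA UB u -> UA - UB = r * set_current N u A.

(* The constant of the previous definition; the default value 0 is taken only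
   when no such constant exists. *)
Definition eff_resistance N A B : R := xget 0 [set r | is_eff_resistance N A B r].

Definition eff_conductance N A B : R := (eff_resistance N A B)^-1.

End Network.

Section ChainNetwork.
Variables (R : realType) (V : finType) (P : V -> V -> R) (mu : V -> R).

Definition chain_dcond x y : R := Num.sqrt (mu x * P x y * (mu y * P y x)).
Definition chain_gam x y : R := Num.sqrt (mu x * P x y / (mu y * P y x)).

(* The network with amp = gam ^ 2 and cond = dcond * (1 + amp) / (2 * gam); the
   lemmas below check that its dcond and gam are the prescribed ones. *)
Definition chain_network : network R V := Network
  (fun x y => (chain_dcond x y * (1 + chain_gam x y ^+ 2) / (2 * chain_gam x y))^-1)
  (fun x y => chain_gam x y ^+ 2).

End ChainNetwork.

Section ChainNetworkFacts.
Variables (R : realType) (V : finType) (e : rel V).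
Variables (P : V -> V -> R) (mu : V -> R).
Hypotheses (eG : connected_graph e) (PM : transition_matrix P).
Hypotheses (Pe : chain_on e P) (irr : irreducible_chain P) (st : stationary P mu).

Lemma nstep_ge0 n x y : 0 <= nstep P n x y.
Proof.
elim: n x => [|n IHn] x /=; first by rewrite ler0n.
by apply: sumr_ge0 => z _; rewrite mulr_ge0 ?IHn ?PM.1.
Qed.

Lemma stationary_nstep n y : \sum_x mu x * nstep P n x y = mu y.
Proof.
have [_ _ stP] := st.
elim: n => [|n IHn] /=.
  rewrite (bigD1 y) //= eqxx mulr1 big1 ?addr0 // => x /negPf ->.
  by rewrite mulr0.
rewrite -[RHS]IHn; under eq_bigr do rewrite mulr_sumr.
rewrite exchange_big /=; apply: eq_bigr => z _.
by rewrite -[in RHS]stP mulr_suml; apply: eq_bigr => x _; rewrite mulrA.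
Qed.

Lemma stationary_gt0 x : 0 < mu x.
Proof.
have [mu_ge0 mu1 _] := st.
have [y mu_y|mu0] := pickP (fun y => mu y != 0); last first.
  have /eqP := mu1; rewrite big1 ?(eq_sym 0) ?oner_eq0 // => y _.
  by apply/eqP/negbFE/mu0.
have [n n_gt0] := irr y x.
rewrite -(stationary_nstep n) (bigD1 y) //= ltr_wpDr //.
  by apply: sumr_ge0 => z _; rewrite mulr_ge0 ?nstep_ge0.
by rewrite mulr_gt0 // lt_def mu_y mu_ge0.
Qed.

Lemma flow_gt0 x y : e x y -> 0 < mu x * P x y.
Proof. by move=> exy; rewrite mulr_gt0 ?Pe // stationary_gt0. Qed.

Lemma chain_gam_gt0 x y : e x y -> 0 < chain_gam P mu x y.
Proof. by move=> exy; rewrite sqrtr_gt0 divr_gt0 ?flow_gt0 // eG.1. Qed.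

Lemma chain_dcond_gt0 x y : e x y -> 0 < chain_dcond P mu x y.
Proof. by move=> exy; rewrite sqrtr_gt0 mulr_gt0 ?flow_gt0 // eG.1. Qed.

Lemma chain_gamV x y : e x y -> chain_gam P mu y x = (chain_gam P mu x y)^-1.
Proof.
move=> exy; rewrite /chain_gam -sqrtrV ?invf_div //.
by rewrite ltW // divr_gt0 ?flow_gt0 // eG.1.
Qed.

Lemma chain_network_gam x y : e x y ->
  gam (chain_network P mu) x y = chain_gam P mu x y.
Proof. by move=> exy; rewrite /gam /= sqrtr_sqr gtr0_norm ?chain_gam_gt0. Qed.

Lemma chain_network_dcond x y : e x y ->
  dcond (chain_network P mu) x y = chain_dcond P mu x y.
Proof.
move=> exy; rewrite /dcond /cond chain_network_gam //= invrK.
have g_gt0 := chain_gam_gt0 exy.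
have g0 : chain_gam P mu x y != 0 by rewrite gt_eqF.
have h0 : 1 + chain_gam P mu x y ^+ 2 != 0 by rewrite gt_eqF // addr_gt0 ?exprn_gt0.
by field; rewrite g0.
Qed.

Lemma chain_network_electric : electric_network e (chain_network P mu).
Proof.
split=> [x y exy|x y exy|x exx] /=.
- have g_gt0 := chain_gam_gt0 exy.
  have g0 : chain_gam P mu x y != 0 by rewrite gt_eqF.
  split.
    rewrite invr_gt0 divr_gt0 ?mulr_gt0 ?chain_dcond_gt0 //.
    by rewrite addr_gt0 ?exprn_gt0.
  rewrite (chain_gamV exy).
  have -> : chain_dcond P mu y x = chain_dcond P mu x y.
    by rewrite /chain_dcond mulrC.
  congr (_^-1); move: g0; set g := chain_gam P mu x y => g0.
  by field.
- by rewrite exprn_gt0 ?chain_gam_gt0 // (chain_gamV exy) exprVn.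
- by rewrite /chain_gam divff ?sqrtr1 ?expr1n // gt_eqF ?flow_gt0.
Qed.

End ChainNetworkFacts.

(* Main.v *)
Require Import Defs.
From HB Require Import structures.
From mathcomp Require Import all_boot all_order all_algebra.
From mathcomp Require Import ring.
From mathcomp Require Import all_classical all_reals all_analysis.

Set Implicit Arguments.
Unset Strict Implicit.
Unset Printing Implicit Defensive.

Import Order.TTheory GRing.Theory Num.Theory.
Import numFieldNormedType.Exports.

Local Open Scope classical_set_scope.
Local Open Scope ring_scope.

(** The currents of the associated network are exactly the drift of the chain.
    Since dcond and gam multiply to the edge flow mu x * P x y, the current
    from x to y is mu y * P y x * u x - mu x * P x y * u y, and stationarity
    makes the total current at x equal to mu x * (u x - (P u) x)
    ([chain_vertex_current]).  So a vertex is free exactly when u is harmonic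
    there for P, also when the chain is not reversible; the amplifiers are what
    turns the asymmetric flow into a network.  In the same way the conductances
    are the symmetrised flows and add up to mu x at the vertex x
    ([chain_total_cond]), which turns the denominator of the theorem into mu(A).

    Let p x be the probability of entering B before A at positive times, and let
    h be 0 on A, 1 on B and p elsewhere.  Conditioning on the first step gives
    p = P h everywhere, so h is harmonic off A and B: it is the potential for the
    boundary values 0 and 1.  By the maximum principle every held potential is
    U_A + (U_B - U_A) h, hence carries the current (U_A - U_B) E out of A,
    where E is the sum over A of mu x * (P h) x = mu x * p x.  Thus E is the
    effective conductance ([chain_eff_conductance]), and dividing by mu(A) gives
    the escape probability.

    The identity p = P h is derived from the law of the finite-dimensional
    cylinders: the escape event is the disjoint union, over n, of the events that
    A and B are first met at time n + 1, and in B.  The cylinder law gives their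
    probabilities by recursion on n ([prob_first_hit]), and summing that recursion
    over n is the first-step equation ([first_hit_series_step]). *)

(** * First entrance into a pair of sets *)

Section FirstHit.
Variables (R : realType) (V : finType) (P : V -> V -> R) (A B : {set V}).

(** After time m the process stays outside A and B for n steps and enters
    B at the next one. *)
Fixpoint first_hit (T : Type) (X : nat -> T -> V) (n m : nat) (w : T) : bool :=
  if n is n'.+1
  then (X m.+1 w \in ~: (A :|: B)) && first_hit X n' m.+1 w
  else X m.+1 w \in B.

(** The probability, from x, of the event [first_hit] with the same n. *)
Fixpoint first_hit_prob (n : nat) (x : V) : R :=
  if n is n'.+1 then \sum_(y in ~: (A :|: B)) P x y * first_hit_prob n' y
  else \sum_(y in B) P x y.

Lemma first_hit_prob_ge0 n x : transition_matrix P -> 0 <= first_hit_prob n x.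
Proof.
move=> [P0 _]; elim: n x => [|n IHn] x /=; apply: sumr_ge0 => // y _.
exact: mulr_ge0.
Qed.

Section Process.
Variables (T : Type) (X : nat -> T -> V).

Lemma first_hitP n m w :
  reflect ((forall k, (k < n)%N -> X (m + k).+1 w \notin A :|: B) /\
           X (m + n).+1 w \in B)
          (first_hit X n m w).
Proof.
elim: n m => [|n IHn] m /=.
  by rewrite addn0; apply: (iffP idP) => [? | []].
apply: (iffP andP) => [[mC /IHn[nC nB]]|[nC nB]].
  split=> [[|k] kn|]; rewrite ?addnS //; first by rewrite addn0 -finset.in_setC.
  by rewrite -addSn; apply: nC.
split; first by rewrite finset.in_setC -[m]addn0 nC.
apply/IHn; split=> [k kn|]; last by rewrite addSn -addnS.
by rewrite addSn -addnS nC.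
Qed.

Lemma first_hit_inj n n' w : first_hit X n 0 w -> first_hit X n' 0 w -> n = n'.
Proof.
move=> /first_hitP[nC nB] /first_hitP[nC' nB'].
have [ltn|ltn|//] := ltngtP n n'.
  by have := nC' _ ltn; rewrite finset.in_setU nB orbT.
by have := nC _ ltn; rewrite finset.in_setU nB' orbT.
Qed.

(** Since A and B are disjoint, the first visit to B precedes that to A exactly
    when the first visit to their union is in B. *)
Lemma hitting_time_ltP (w : T) : A :&: B = finset.set0 ->
  (hitting_time R X B w < hitting_time R X A w)%E <->
  exists n, first_hit X n 0 w.
Proof.
move=> AB; split=> [/[dup] ltBA /ereal_inf_lt[_ [t0 t0B <-] _]|[n /first_hitP[nC nB]]].
  have ex_t : exists t, (0 < t)%N && (X t w \in B) by exists t0.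
  (* The least positive time t of a visit to B; a visit to A before t would
     make the hitting time of A at most that of B. *)
  have [t /andP[t_gt0 tB] t_min] := find_ex_minn ex_t.
  exists t.-1; apply/first_hitP; rewrite add0n prednK //; split=> // k kt.
  have lt_kt : (k.+1 < t)%N by rewrite -[t]prednK.
  rewrite finset.in_setU negb_or; apply/andP; split; apply/negP => kX.
    have: (hitting_time R X A w <= hitting_time R X B w)%E.
      apply/ereal_infP => _ [s sB <-].
      apply: (@le_trans _ _ (k.+1%:R)%:E).
        by apply: ereal_inf_lbound; exists k.+1.
      by rewrite lee_fin ler_nat (leq_trans (ltnW lt_kt)) // t_min.
    by rewrite leNgt ltBA.
  by have := t_min k.+1 kX; rewrite leqNgt lt_kt.
apply: (@le_lt_trans _ _ (n.+1%:R)%:E).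
  by apply: ereal_inf_lbound; exists n.+1.
apply: (@lt_le_trans _ _ (n.+2%:R)%:E); first by rewrite lte_fin ltr_nat.
apply/ereal_infP => _ [[|t] //= tA <-]; rewrite lee_fin ler_nat ltnS ltnNge.
apply/negP; rewrite leq_eqVlt => /predU1P[tn|/nC]; last first.
  by rewrite add0n finset.in_setU tA.
by have /finset.setP/(_ (X t.+1 w)) := AB; rewrite !inE tA tn nB.
Qed.

End Process.

(** * First-step analysis *)

Section Markov.
Variables (d : measure_display) (Omega : measurableType d).
Variables (X : nat -> Omega -> V).

Lemma measure_fiber_sum (Q : probability Omega R) (E : set Omega)
    (Z : Omega -> V) (C : {set V}) :
    measurable E -> (forall y, measurable [set w | Z w = y]) ->
  Q (E `&` [set w | Z w \in C]) =
  (\sum_(y in C) Q (E `&` [set w | Z w = y]))%E.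
Proof.
move=> mE mZ.
have -> : E `&` [set w | Z w \in C] =
          \bigcup_(y in [set` C]) (E `&` [set w | Z w = y]).
  apply/seteqP; split=> [w [Ew Cw]|w [y Cy [Ew Zw]]]; first by exists (Z w).
  by split=> //=; rewrite Zw.
rewrite measure_fin_bigcup //.
- rewrite -[RHS]big_enum [RHS]fsbig_seq ?enum_uniq //=.
  suff -> : [set` C] = [set` enum C] by [].
  by apply/seteqP; split=> y /=; rewrite mem_enum.
- by move=> y z _ _ [w [[_ <-] [_ <-]]].
- by move=> y _; apply: measurableI.
Qed.

Definition cylinder n (s : nat -> V) := [set w | forall k, (k <= n)%N -> X k w = s k].

(** The trajectory s with its value at time m + 1 replaced by y. *)
Definition extend m (s : nat -> V) y (k : nat) := if k == m.+1 then y else s k.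

Lemma cylinderS m s y :
  cylinder m.+1 (extend m s y) = cylinder m s `&` [set w | X m.+1 w = y].
Proof.
apply/seteqP; split=> [w ws|w [ws wy] k].
  split=> [k km|] /=; last by rewrite (ws _ (leqnn _)) /extend eqxx.
  by rewrite (ws _ (leqW km)) /extend ltn_eqF.
rewrite leq_eqVlt /extend => /predU1P[->|km]; first by rewrite eqxx; exact: wy.
by rewrite ltn_eqF // ws.
Qed.

Variables (Q : probability Omega R) (x : V).
Hypotheses (PM : transition_matrix P) (XQ : markov_from P X Q x).

Let mX n y : measurable [set w | X n w = y].
Proof. by case: XQ. Qed.

Lemma measurable_cylinder m s : measurable (cylinder m s).
Proof.
elim: m => [|m IHm].
  suff -> : cylinder 0 s = [set w | X 0%N w = s 0%N] by [].
  apply/seteqP; split=> [w|w /= w0 k]; first exact.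
  by rewrite leqn0 => /eqP->.
suff -> : s = extend m s (s m.+1) by rewrite cylinderS; apply: measurableI.
by apply/funext => k; rewrite /extend; case: eqP => [->|].
Qed.

Lemma measurable_mem n (C : {set V}) : measurable [set w | X n w \in C].
Proof.
suff -> : [set w | X n w \in C] = \bigcup_(y in [set` C]) [set w | X n w = y].
  by apply: fin_bigcup_measurable => // y _.
by apply/seteqP; split=> [w wC|w [y yC /= ->]//]; exists (X n w).
Qed.

Lemma measurable_first_hit n m : measurable [set w | first_hit X n m w].
Proof.
elim: n m => [|n IHn] m; first exact: measurable_mem.
have -> : [set w | first_hit X n.+1 m w] =
    [set w | X m.+1 w \in ~: (A :|: B)] `&` [set w | first_hit X n m.+1 w].
  by apply/seteqP; split=> w /= => [/andP|/andP].
by apply: measurableI => //; apply: measurable_mem.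
Qed.

(** The Markov property for the event [first_hit], by recursion on n: splitting
    over the value y of the next state turns the given cylinder into one that is
    longer by one step, whose probability has the factor P (s m) y.  The cylinder
    has to be arbitrary for the induction to go through. *)
Lemma cylinder_first_hit n m s :
  Q (cylinder m s `&` [set w | first_hit X n m w]) =
  (Q (cylinder m s) * (first_hit_prob n (s m))%:E)%E.
Proof.
have [_ _ QS] := XQ.
have QcylS k t y : Q (cylinder k.+1 (extend k t y)) =
    (Q (cylinder k t) * (P (t k) y)%:E)%E.
  rewrite /cylinder QS /extend eqxx ltn_eqF //; congr (Q _ * _)%E.
  by apply/seteqP; split=> w wt j jk; have := wt _ jk; rewrite ltn_eqF.
elim: n m s => [|n IHn] m s /=.
  rewrite measure_fiber_sum //; last exact: measurable_cylinder.
  rewrite -sumEFin ge0_sume_distrr => [|y _]; last by rewrite lee_fin PM.1.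
  by apply: eq_bigr => y _; rewrite -cylinderS QcylS.
have -> : [set w | first_hit X n.+1 m w] =
    [set w | first_hit X n m.+1 w] `&` [set w | X m.+1 w \in ~: (A :|: B)].
  by apply/seteqP; split=> w /= => [/andP[]|[? ?]] //; apply/andP.
rewrite setIA measure_fiber_sum //; last first.
  by apply: measurableI; [apply: measurable_cylinder | apply: measurable_first_hit].
rewrite -sumEFin ge0_sume_distrr => [|y _]; last first.
  by rewrite lee_fin mulr_ge0 ?PM.1 ?first_hit_prob_ge0.
apply: eq_bigr => y _.
by rewrite setIAC -cylinderS IHn QcylS /extend eqxx EFinM muleA.
Qed.

Lemma prob_first_hit n :
  Q [set w | first_hit X n 0 w] = (first_hit_prob n x)%:E.
Proof.
have [_ Qx _] := XQ.
have cyl0 : cylinder 0 (fun=> x) = [set w | X 0%N w = x].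
  apply/seteqP; split=> [w w0|w /= w0 k]; first exact: w0.
  by rewrite leqn0 => /eqP->.
have := cylinder_first_hit n 0 (fun=> x); rewrite cyl0 Qx mul1e => <-.
have mF := measurable_first_hit n 0.
(* The paths that do not start at x carry no mass. *)
rewrite -[X in Q X]setIT -(setUv [set w | X 0%N w = x]) setIUr.
rewrite measureU //; first last.
- by rewrite setIACA setICr setI0.
- by apply: measurableI => //; apply: measurableC.
- exact: measurableI.
rewrite [X in (_ + X)%E](_ : _ = 0%E) ?adde0 1?setIC //.
apply/eqP; rewrite eq_le measure_ge0 andbT.
have <- : Q (~` [set w | X 0%N w = x]) = 0%E.
  by rewrite probability_setC // Qx subee.
have mN : measurable (~` [set w | X 0%N w = x]) by exact: measurableC.
by apply: le_measure; rewrite ?inE; [exact: measurableI | | exact: subIsetl].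
Qed.

Lemma escape_bigcup : A :&: B = finset.set0 ->
  [set w | (hitting_time R X B w < hitting_time R X A w)%E] =
  \bigcup_n [set w | first_hit X n 0 w].
Proof.
move=> AB; apply/seteqP; split=> w.
  by move=> /(hitting_time_ltP _ _ AB)[n hn]; exists n.
by move=> [n _ hn]; apply/(hitting_time_ltP _ _ AB); exists n.
Qed.

Lemma measurable_escape : A :&: B = finset.set0 ->
  measurable [set w | (hitting_time R X B w < hitting_time R X A w)%E].
Proof.
move=> /escape_bigcup->; apply: bigcup_measurable => n _.
exact: measurable_first_hit.
Qed.

Lemma prob_escape : A :&: B = finset.set0 ->
  Q [set w | (hitting_time R X B w < hitting_time R X A w)%E] =
  (\sum_(0 <= n <oo) (first_hit_prob n x)%:E)%E.
Proof.
move=> AB; have mE := measurable_escape AB.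
rewrite escape_bigcup // in mE *; rewrite measure_semi_bigcup //.
- by apply: eq_eseriesr => n _; apply: prob_first_hit.
- by move=> n; apply: measurable_first_hit.
- by move=> n n' _ _ [w [wn wn']]; apply: first_hit_inj wn wn'.
Qed.

End Markov.

(** The first step leads either into B, or to a state y outside A and B from
    which the escape starts afresh. *)
Lemma first_hit_series_step x : transition_matrix P ->
  (\sum_(0 <= n <oo) (first_hit_prob n x)%:E)%E =
  (\sum_(y in B) (P x y)%:E + \sum_(y in ~: (A :|: B))
     (P x y)%:E * \sum_(0 <= n <oo) (first_hit_prob n y)%:E)%E.
Proof.
move=> PM; have f0 n y : (0 <= (first_hit_prob n y)%:E)%E.
  by rewrite lee_fin first_hit_prob_ge0.
rewrite nneseries_recl // -nneseries_addn //= -sumEFin; congr (_ + _)%E.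
under eq_eseriesr => n _ do rewrite addn1 /= -sumEFin.
rewrite nneseries_sum => [|y n _]; last first.
  by rewrite lee_fin mulr_ge0 ?PM.1 ?first_hit_prob_ge0.
apply: eq_bigr => y _; rewrite -nneseriesZl //.
Qed.

End FirstHit.

(** * The maximum principle *)

Section Harmonic.
Variables (R : realType) (V : finType) (e : rel V) (P : V -> V -> R).
Hypotheses (eG : connected_graph e) (PM : transition_matrix P).
Hypothesis Pe : chain_on e P.
Implicit Types (u : V -> R) (D : {set V}).

(** A mean of values that are at most M equals M only if every value with a
    positive weight is M. *)
Lemma harmonic_max_step u M x y :
    (forall z, u z <= M) -> u x = M -> u x = \sum_z P x z * u z ->
  e x y -> u y = M.
Proof.
move=> uM ux harm exy.
have sum0 : \sum_z P x z * (M - u z) = 0.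
  under eq_bigr do rewrite mulrBr.
  by rewrite sumrB -mulr_suml PM.2 mul1r -harm ux subrr.
have /eqP := sum0; rewrite psumr_eq0 => [/allP/(_ y)|z _]; last first.
  by rewrite mulr_ge0 ?PM.1 // subr_ge0.
rewrite mem_index_enum => /(_ isT).
by rewrite /= mulf_eq0 gt_eqF ?Pe //= subr_eq0 => /eqP.
Qed.

(** Along a path from x to D the value stays M until the path meets D. *)
Lemma maximum_principle u D M x :
    D != finset.set0 -> (forall y, u y <= M) -> u x = M ->
    (forall y, y \notin D -> u y = \sum_z P y z * u z) ->
  exists2 y, y \in D & u y = M.
Proof.
move=> /set0Pn[b Db] uM ux harm.
have /connectP[p] := eG.2 x b.
elim: p x ux => [|y p IHp] x ux /=; first by move=> _ bx; exists b; rewrite // bx.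
move=> /andP[exy pth] bl.
have [xD|xD] := boolP (x \in D); first by exists x.
by apply: (IHp y) => //; apply: harmonic_max_step (harm _ xD) exy.
Qed.

Lemma harmonic_eq0 u D :
    D != finset.set0 -> (forall y, y \in D -> u y = 0) ->
    (forall y, y \notin D -> u y = \sum_z P y z * u z) ->
  forall x, u x = 0.
Proof.
move=> D0.
suff le0 w : (forall y, y \in D -> w y = 0) ->
    (forall y, y \notin D -> w y = \sum_z P y z * w z) -> forall x, w x <= 0.
  move=> uD harm x; apply/eqP; rewrite eq_le le0 //= -oppr_le0.
  apply: (le0 (fun x => - u x)) => [y yD|y yD]; first by rewrite uD ?oppr0.
  by rewrite harm // -sumrN; apply: eq_bigr => z _; rewrite mulrN.
move=> wD harm x.
have [m _ m_max] := @arg_maxP _ _ V x xpredT w isT.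
have [y yD wm] := maximum_principle D0 (fun z => m_max z isT) erefl harm.
by rewrite -(wD y yD) wm; apply: m_max.
Qed.

End Harmonic.

(** * The network of the chain *)

Section ChainCurrents.
Variables (R : realType) (V : finType) (e : rel V).
Variables (P : V -> V -> R) (mu : V -> R).
Hypotheses (eG : connected_graph e) (PM : transition_matrix P).
Hypotheses (Pe : chain_on e P) (irr : irreducible_chain P).
Hypothesis st : stationary P mu.
Implicit Types (u h : V -> R) (A B : {set V}).

Let N := chain_network P mu.

Lemma chain_on_eq0 x y : ~~ e x y -> P x y = 0.
Proof.
by move=> nexy; apply/eqP; rewrite eq_le PM.1 andbT leNgt Pe.
Qed.

(** sqrt (a * b) * sqrt (a / b) = a for the two opposite flows a and b. *)
Lemma chain_dcond_gam x y : e x y ->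
  chain_dcond P mu x y * chain_gam P mu x y = mu x * P x y.
Proof.
move=> exy; have a_gt0 := flow_gt0 PM Pe irr st exy.
have b_gt0 : 0 < mu y * P y x by rewrite (flow_gt0 PM Pe irr st) // eG.1.
rewrite /chain_dcond /chain_gam -sqrtrM; last by rewrite mulr_ge0 // ltW.
by rewrite mulrACA divff ?gt_eqF // mulr1 -expr2 sqrtr_sqr gtr0_norm.
Qed.

Lemma chain_dcondC x y : chain_dcond P mu x y = chain_dcond P mu y x.
Proof. by rewrite /chain_dcond mulrC. Qed.

Lemma chain_current u x y : e x y ->
  current N u x y = mu y * P y x * u x - mu x * P x y * u y.
Proof.
move=> exy; have eyx : e y x by rewrite eG.1.
rewrite /current (chain_network_dcond eG PM Pe irr st) //.
rewrite !(chain_network_gam eG PM Pe irr st) //.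
by rewrite -(chain_dcond_gam exy) -(chain_dcond_gam eyx) (chain_dcondC y); ring.
Qed.

Lemma chain_outflow x : \sum_(y | e x y) mu x * P x y = mu x.
Proof.
rewrite -mulr_sumr -[RHS]mulr1 -(PM.2 x) [in LHS]big_mkcond /=; congr (_ * _).
by apply: eq_bigr => y _; case: ifPn => // /chain_on_eq0.
Qed.

(** This is where stationarity enters. *)
Lemma chain_inflow x : \sum_(y | e x y) mu y * P y x = mu x.
Proof.
have [_ _ stP] := st; rewrite -[RHS]stP big_mkcond /=.
apply: eq_bigr => y _; case: ifPn => //.
by rewrite eG.1 => /chain_on_eq0->; rewrite mulr0.
Qed.

(** The inflow mu y * P y x multiplies u x and sums to mu x, while the outflow
    mu x * P x y weights the potentials of the neighbours. *)
Lemma chain_vertex_current u x :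
  vertex_current e N u x = mu x * (u x - \sum_y P x y * u y).
Proof.
rewrite /vertex_current; under eq_bigr => y exy do rewrite chain_current //.
rewrite sumrB -mulr_suml chain_inflow mulrBr mulr_sumr; congr (_ - _).
rewrite big_mkcond /=; apply: eq_bigr => y _; case: ifPn => [_|/chain_on_eq0->].
  by rewrite mulrA.
by rewrite mul0r mulr0.
Qed.

Lemma chain_cond x y : e x y ->
  cond N x y = (mu x * P x y + mu y * P y x) / 2.
Proof.
move=> exy; have eyx : e y x by rewrite eG.1.
have g0 : chain_gam P mu x y != 0 by rewrite gt_eqF // (chain_gam_gt0 eG PM Pe irr st).
rewrite -(chain_dcond_gam exy) -(chain_dcond_gam eyx) (chain_dcondC y).
rewrite (chain_gamV eG PM Pe irr st exy) /cond /= invrK.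
by field.
Qed.

Lemma chain_total_cond x : \sum_(y | e x y) cond N x y = mu x.
Proof.
under eq_bigr => y exy do rewrite chain_cond //.
rewrite -mulr_suml big_split /= chain_outflow chain_inflow.
by field.
Qed.

(** Here h is the potential of the network with A held at 0 and B held at 1. *)
Section UnitPotential.
Variables (A B : {set V}) (h : V -> R).
Hypotheses (A0 : A != finset.set0) (B0 : B != finset.set0).
Hypotheses (h_ge0 : forall x, 0 <= h x).
Hypotheses (hA : forall x, x \in A -> h x = 0).
Hypotheses (hB : forall x, x \in B -> h x = 1).
Hypothesis h_harm : forall x, x \notin A :|: B -> h x = \sum_y P x y * h y.

Let escape_rate := \sum_(x in A) mu x * \sum_y P x y * h y.

(** If the rate vanished, h would be harmonic on A too, so that - h, which has
    its maximum 0 on A, would take the value 0 on B as well. *)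
Lemma escape_rate_gt0 : 0 < escape_rate.
Proof.
have mu_gt0 := stationary_gt0 PM irr st.
have Ph_ge0 x : 0 <= \sum_y P x y * h y.
  by apply: sumr_ge0 => y _; rewrite mulr_ge0 ?PM.1.
have t_ge0 x : x \in A -> 0 <= mu x * \sum_y P x y * h y.
  by move=> _; rewrite mulr_ge0 // ltW.
rewrite lt_def sumr_ge0 ?andbT //; apply/negP.
rewrite psumr_eq0 // => /allP Ph0.
have hAP x : x \in A -> \sum_y P x y * h y = 0.
  move=> xA; have /implyP/(_ xA) := Ph0 x (mem_index_enum x).
  by rewrite mulf_eq0 gt_eqF //= => /eqP.
have [a aA] := set0Pn _ A0.
have [|||y yB /eqP] := @maximum_principle _ _ e P eG PM Pe (fun x => - h x) B 0 a B0.
- by move=> x; rewrite oppr_le0.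
- by rewrite /= hA ?oppr0.
- move=> x xB /=; under eq_bigr do rewrite mulrN.
  rewrite sumrN; congr (- _).
  have [xA|xA] := boolP (x \in A); first by rewrite hAP ?hA.
  by rewrite h_harm // finset.in_setU negb_or xA.
by rewrite /= hB // oppr_eq0 oner_eq0.
Qed.

(** The difference of the two sides vanishes on A and B and is harmonic
    elsewhere. *)
Lemma held_potentialE UA UB u x :
  held_potential e N A B UA UB u -> u x = UA + (UB - UA) * h x.
Proof.
move=> [uA uB uF]; apply/eqP; rewrite -subr_eq0; apply/eqP; move: x.
have AB0 : A :|: B != finset.set0.
  by have [a aA] := set0Pn _ A0; apply/set0Pn; exists a; rewrite finset.in_setU aA.
apply: (harmonic_eq0 eG PM Pe AB0 (u := fun x => u x - (UA + (UB - UA) * h x))).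
  move=> y; rewrite finset.in_setU => yAB.
  have [yA|yA] := boolP (y \in A); first by rewrite uA ?hA // mulr0 addr0 subrr.
  have yB : y \in B by rewrite (negPf yA) in yAB.
  by rewrite uB ?hB //; ring.
move=> y yAB; have /eqP := uF y yAB.
rewrite chain_vertex_current mulf_eq0 gt_eqF ?(stationary_gt0 PM irr st) //=.
rewrite subr_eq0 => /eqP->; rewrite h_harm //.
under [RHS]eq_bigr do rewrite mulrBr mulrDr mulrCA.
by rewrite sumrB big_split /= -mulr_suml PM.2 mul1r -mulr_sumr.
Qed.

Lemma held_set_current UA UB u :
  held_potential e N A B UA UB u -> set_current e N u A = (UA - UB) * escape_rate.
Proof.
move=> /[dup] held [uA _ _]; rewrite /set_current mulr_sumr.
apply: eq_bigr => x xA; rewrite chain_vertex_current uA //.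
under eq_bigr do rewrite (held_potentialE _ held) mulrDr mulrCA.
by rewrite big_split /= -mulr_suml PM.2 -mulr_sumr; ring.
Qed.

(** The current formula for all held potentials shows that the inverse of the
    rate is an effective resistance; evaluated at h it shows that there is no
    other, so the chosen constant is this one. *)
Lemma chain_eff_conductance : eff_conductance e N A B = escape_rate.
Proof.
have E_gt0 := escape_rate_gt0.
have E0 : escape_rate != 0 by rewrite gt_eqF.
have h_held : held_potential e N A B 0 1 h.
  split=> // x xAB; rewrite chain_vertex_current h_harm // subrr mulr0 //.
have ex_r : exists r, is_eff_resistance e N A B r.
  exists escape_rate^-1; split=> [|UA UB u held]; first by rewrite invr_gt0.
  by rewrite (held_set_current held) mulrC mulfK.
have [_ /(_ 0 1 h h_held)] := xgetPex 0 ex_r.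
rewrite -/(eff_resistance e N A B) (held_set_current h_held) /eff_conductance.
rewrite sub0r mulN1r mulrN => /oppr_inj rE.
by rewrite -[LHS]mulr1 rE mulKf //; apply: contra_eq_neq rE => ->; rewrite mul0r oner_eq0.
Qed.

End UnitPotential.
End ChainCurrents.

(** * The escape probability *)

Theorem mainTheorem9 (R : realType) (V : finType) (e : rel V)
    (P : V -> V -> R) (mu : V -> R)
    (d : measure_display) (Omega : measurableType d)
    (X : nat -> Omega -> V) (Pr : V -> probability Omega R)
    (A B : {set V})
    (eG : connected_graph e)
    (PM : transition_matrix P)
    (Pe : chain_on e P)
    (irr : irreducible_chain P)
    (st : stationary P mu)
    (chainX : forall x, markov_from P X (Pr x) x)
    (A0 : A != finset.set0) (B0 : B != finset.set0)
    (AB : A :&: B = finset.set0) :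
  let N := chain_network P mu in
  (\sum_(x in A) (mu x / \sum_(z in A) mu z)%:E *
     Pr x [set w | hitting_time R X B w < hitting_time R X A w])%E =
  (eff_conductance e N A B / \sum_(z in A) \sum_(y | e z y) cond N z y)%:E.
Proof.
move=> N.
set esc := [set w | _].
have esc_fin x : Pr x esc \is a fin_num.
  by apply: fin_num_measure; apply: measurable_escape (chainX x) AB.
pose p x := fine (Pr x esc).
have p_ge0 x : 0 <= p x by rewrite fine_ge0 ?measure_ge0.
(* On A the potential is 0 and not p, since p counts only positive times; p and
   h agree outside A and B, and p = P h holds everywhere. *)
pose h x := if x \in A then 0 else if x \in B then 1 else p x.
have hA x : x \in A -> h x = 0 by rewrite /h => ->.
have hB x : x \in B -> h x = 1.
  move=> xB; rewrite /h xB; case: ifPn => // xA.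
  by have /finset.setP/(_ x) := AB; rewrite !inE xA xB.
have pE x : p x = \sum_y P x y * h y.
  have series y : (p y)%:E = (\sum_(0 <= n <oo) (first_hit_prob P A B n y)%:E)%E.
    by rewrite fineK // (prob_escape PM (chainX y) AB).
  apply: EFin_inj; rewrite series first_hit_series_step //.
  under [X in (_ + X)%E]eq_bigr do rewrite -series -EFinM.
  rewrite !sumEFin -EFinD; congr (_%:E).
  rewrite big_mkcond [X in _ + X]big_mkcond -big_split /=.
  apply: eq_bigr => y _; rewrite finset.in_setC finset.in_setU.
  have [yB|yB] := boolP (y \in B); first by rewrite orbT addr0 hB // mulr1.
  by rewrite orbF add0r /h (negPf yB); case: (y \in A); rewrite /= ?mulr0.
have h_harm x : x \notin A :|: B -> h x = \sum_y P x y * h y.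
  by rewrite !inE negb_or /h -pE => /andP[/negPf-> /negPf->].
have h_ge0 x : 0 <= h x by rewrite /h; case: ifP => // _; case: ifP.
rewrite (chain_eff_conductance eG PM Pe irr st A0 B0 h_ge0 hA hB h_harm).
under [X in (_ / X)%:E]eq_bigr do rewrite (chain_total_cond eG PM Pe irr st).
rewrite mulr_suml -sumEFin; apply: eq_bigr => x _.
by rewrite -(fineK (esc_fin x)) -/(p x) -pE -EFinM mulrAC.
Qed.
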